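(* For any $d$-dimensional $k$-Fourier-sparse signal $x:\mathbb{R}^d\to\mathbb{C}$ and any duration $T>0$, $$\max_{t\in[0,T]^d}|x(t)|^2\le k^{O(d)}\|x\|_T^2,$$ where $\|x\|_T^2=\frac{1}{T^d}\int_{[0,T]^d}|x(t)|^2\,dt$.
   Context: A $d$-dimensional $k$-Fourier-sparse signal is a function of the form $x(t)=\sum_{j=1}^k v_je^{2\pi i\langle f_j,t\rangle}$ with $v_j\in\mathbb{C}$, $f_j\in\mathbb{R}^d$. The $O(\cdot)$ hides an absolute constant. *)

(* Defs.v *)
From HB Require Import structures.
From mathcomp Require Import all_boot all_order all_algebra.
From mathcomp Require Import all_classical all_reals all_analysis.
From mathcomp Require Import complex.
Set Implicit Arguments. Unset Strict Implicit. Unset Printing Implicit Defensive.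
Import Order.TTheory GRing.Theory Num.Theory.
Local Open Scope ring_scope.
Local Open Scope complex_scope.

Definition expi {R : realType} (theta : R) : R[i] := (cos theta) +i* (sin theta).

Definition sqmod {R : realType} (z : R[i]) : R := (complex.Re z) ^+ 2 + (complex.Im z) ^+ 2.

Definition dotR {R : realType} (d : nat) (f t : 'rV[R]_d) : R :=
  \sum_(i < d) f ord0 i * t ord0 i.

Definition sparse_signal {R : realType} (d k : nat) (v : 'I_k -> R[i])
    (f : 'I_k -> 'rV[R]_d) (t : 'rV[R]_d) : R[i] :=
  \sum_(j < k) v j * expi (2 * pi * dotR (f j) t).

Definition cube {R : realType} (d : nat) (T : R) : set 'rV[R]_d :=
  [set t | forall i : 'I_d, 0 <= t ord0 i <= T].

(* Iterated Lebesgue integral over [0,T]^n of a function of the coordinates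
   (coordinates 0..n-1 are integrated over [0,T], innermost = coordinate 0). *)
Fixpoint iter_int {R : realType} (T : R) (n : nat) (h : (nat -> R) -> R) : R :=
  match n with
  | 0 => h (fun _ => 0)
  | n.+1 => Rintegral (@lebesgue_measure R) `[0, T]%classic
              (fun s => iter_int T n (fun u => h (fun m => if m == n then s else u m)))
  end.

Definition cube_integral {R : realType} (d : nat) (T : R) (g : 'rV[R]_d -> R) : R :=
  iter_int T d (fun u => g (\row_(i < d) u (nat_of_ord i))).

Definition normT2 {R : realType} (d : nat) (T : R) (x : 'rV[R]_d -> R[i]) : R :=
  (T ^+ d)^-1 * cube_integral T (fun t => sqmod (x t)).

(* Main.v *)
(* In one variable, given unimodular z_1, ..., z_k one looks for a polynomial
   P = 1 + sum_(l >= 1) p_l X^l of degree O(k^3) with bounded coefficients that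
   vanishes at every z_j. The product of the functions (1 - w / z_j) / (1 - r w / z_j)
   with r = 1 - 1/(2k) has the right zeros and is bounded on the unit circle by
   (2 / (1 + r))^k = O(1); truncating the Taylor series of each factor keeps this
   bound, and Cauchy's estimate then bounds the p_l. With z_j = exp(2 pi i f_j tau)
   this gives x(t) = - sum_l p_l x(t + l tau) for every tau, hence
   |x(t)|^2 <= k^O(1) sum_l |x(t + l tau)|^2, and integrating over tau bounds
   |x(t)|^2 by k^O(1) times the mean of |x|^2. In d variables this is applied one
   coordinate at a time. *)
Require Import Defs.
From HB Require Import structures.
From mathcomp Require Import all_boot all_order all_algebra.
From mathcomp Require Import all_classical all_reals all_analysis.
From mathcomp Require Import complex.
From mathcomp Require Import ring lra zify.
Set Implicit Arguments.
Unset Strict Implicit.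
Import Order.TTheory GRing.Theory Num.Theory.
Import numFieldNormedType.Exports.
Local Open Scope ring_scope.

(** * Bernoulli's inequality, roots of unity and coefficient bounds *)

Lemma bernoulli_le (R : numDomainType) (x : R) (n : nat) :
  -1 <= x -> 1 + n%:R * x <= (1 + x) ^+ n.
Proof.
move=> xN1; elim: n => [|n IHn]; first by rewrite expr0 mul0r addr0.
have x1 : 0 <= 1 + x by rewrite addrC -lerBlDr sub0r.
have xr : x \is Num.real by rewrite -[x](addKr 1) rpredD ?rpredN ?ger0_real.
rewrite exprS; apply: le_trans (ler_wpM2l x1 IHn).
rewrite -subr_ge0 -natr1 [X in 0 <= X](_ : _ = n%:R * (x * x)); last by ring.
by rewrite mulr_ge0 // -expr2 real_exprn_even_ge0.
Qed.

Lemma sum_prim_root (F : fieldType) (n : nat) (w : F) (i : nat) :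
  n.-primitive_root w ->
  \sum_(j < n) (w ^+ i) ^+ j = if (n %| i)%N then n%:R else 0.
Proof.
move=> wP; rewrite (prim_order_dvd wP); case: eqP => [->|/eqP wi].
  by under eq_bigr => j _ do rewrite expr1n; rewrite sumr_const card_ord.
apply: (mulfI (_ : w ^+ i - 1 != 0)); first by rewrite subr_eq0.
by rewrite -subrX1 mulr0 exprAC (prim_expr_order wP) expr1n subrr.
Qed.

Lemma norm_prim_root (F : numFieldType) (n : nat) (w : F) :
  n.-primitive_root w -> `|w| = 1.
Proof.
move=> wP; have n0 := prim_order_gt0 wP.
apply/eqP; rewrite -(@pexpr_eq1 _ _ n) //.
by rewrite -normrX (prim_expr_order wP) normr1.
Qed.

(* Cauchy's estimate, with the circle replaced by the n-th roots of unity. *)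
Lemma norm_coef_le (F : numFieldType) (n : nat) (w : F) (p : {poly F}) (B : F) :
  n.-primitive_root w -> (size p <= n)%N ->
  (forall i : nat, `|p.[w ^+ i]| <= B) -> forall l, `|p`_l| <= B.
Proof.
move=> wP sp pB l; have n0 := prim_order_gt0 wP.
have [ln|nl] := ltnP l n; last first.
  by rewrite nth_default ?(leq_trans sp) // normr0 (le_trans _ (pB 0%N)).
have nF : 0 < n%:R :> F by rewrite ltr0n.
(* Discrete Fourier inversion, with the exponent [n - l] standing for [- l] so that no inverse of
   [w] is needed. *)
have E : p`_l * n%:R = \sum_(i < n) p.[w ^+ i] * w ^+ ((n - l) * i).
  under eq_bigr => i _ do rewrite (horner_coef_wide _ sp) mulr_suml.
  rewrite exchange_big /= (bigD1 (Ordinal ln)) //= [X in _ + X]big1 => [|j jl].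
    rewrite addr0.
    under eq_bigr => i _ do
      rewrite -mulrA -exprM mulnC -exprD -mulnDl subnKC 1?ltnW // exprM.
    by rewrite -mulr_sumr sum_prim_root // dvdnn.
  under eq_bigr => i _ do rewrite -mulrA -exprM [(i * j)%N]mulnC -exprD -mulnDl exprM.
  rewrite -mulr_sumr sum_prim_root // ifN ?mulr0 //.
  apply: contra jl => /dvdnP[q E]; rewrite -val_eqE /=; have := ltn_ord j => jn.
  (* The exponent [n - l + j] lies strictly between 0 and 2n, so it is a multiple of n only for j =
     l. *)
  have q1 : q = 1%N by nia.
  by apply/eqP; lia.
rewrite -(ler_pM2r nF) -[X in `|_| * X]normr_nat -normrM E.
apply: le_trans (ler_norm_sum _ _ _) _.
rewrite mulr_natr -[X in _ *+ X]card_ord -sumr_const; apply: ler_sum => i _.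
by rewrite normrM normrX (norm_prim_root wP) expr1n mulr1.
Qed.

(** * Polynomials of controlled size vanishing at given points of the unit circle *)

(** On the circle, 4 |1 - r z|^2 - (1 + r)^2 |1 - z|^2 = (1 - r)^2 |1 + z|^2, which is
    nonnegative. *)
Lemma norm1B_le (C : numClosedFieldType) (r z : C) : 0 <= r -> `|z| = 1 ->
  (1 + r) * `|1 - z| <= 2 * `|1 - r * z|.
Proof.
move=> r0 z1; have r1 : 0 <= 1 + r by rewrite addr_ge0.
rewrite -ler_sqr ?nnegrE ?mulr_ge0 // !exprMn !normCK !rmorphB !rmorphM !rmorph1 /=.
have rc : r^* = r by apply/CrealP/ger0_real.
have zz : z * z^* = 1 by rewrite -normCK z1 expr1n.
rewrite rc -subr_ge0.
have -> : 2 ^+ 2 * ((1 - r * z) * (1 - r * z^*)) -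
    (1 + r) ^+ 2 * ((1 - z) * (1 - z^*)) =
    (1 - r) ^+ 2 * `|1 + z| ^+ 2.
  rewrite normCK rmorphD rmorph1 /=.
  rewrite (_ : (1 - r * z) * _ = 1 - r * z - r * z^* + r ^+ 2 * (z * z^*)); last by ring.
  rewrite (_ : (1 - z) * _ = 1 - z - z^* + z * z^*); last by ring.
  rewrite (_ : (1 + z) * _ = 1 + z + z^* + z * z^*); last by ring.
  by rewrite zz; ring.
apply: mulr_ge0; last exact: exprn_ge0.
by rewrite real_exprn_even_ge0 // rpredB ?ger0_real.
Qed.

(* The rational function (1 - z) / (1 - r z) is 1 at 0, vanishes at 1 and is
   bounded by 2 / (1 + r) on the circle; this is its Taylor polynomial of degree
   N, with the non-constant part rescaled to keep the zero at 1. *)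
Definition notch (C : fieldType) (r : C) (N : nat) : {poly C} :=
  1 - ((1 - r) / (1 - r ^+ N)) *: ('X * \sum_(l < N) (r *: 'X) ^+ l).

Lemma size_notch (C : fieldType) (r : C) (N : nat) : (size (notch r N) <= N.+1)%N.
Proof.
rewrite (leq_trans (size_polyD _ _)) // geq_max size_poly1 size_polyN /=.
rewrite (leq_trans (size_scale_leq _ _)) //.
rewrite (leq_trans (size_polyMleq _ _)) // size_polyX /=.
rewrite ltnS (leq_trans (size_sum _ _ _)) //.
apply/bigmax_leqP => l _; rewrite exprZn (leq_trans (size_scale_leq _ _)) //.
by rewrite size_polyXn.
Qed.

Lemma horner_notch (C : fieldType) (r z : C) (N : nat) :
  (notch r N).[z] = 1 - (1 - r) / (1 - r ^+ N) * (z * \sum_(l < N) (r * z) ^+ l).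
Proof.
rewrite /notch hornerD hornerN hornerZ hornerM hornerX hornerC horner_sum.
by under eq_bigr => l _ do rewrite horner_exp hornerZ hornerX.
Qed.

(** Clearing both denominators exhibits the main term 1 - z of the rational function, plus two
    truncation errors carrying a factor r^N. *)
Lemma horner_notchM (C : fieldType) (r z : C) (N : nat) : 1 - r ^+ N != 0 ->
  (notch r N).[z] * (1 - r * z) * (1 - r ^+ N) =
    1 - z - r ^+ N * (1 - r * z) + (1 - r) * r ^+ N * z ^+ N.+1.
Proof.
move=> rN; rewrite horner_notch.
have S : (\sum_(l < N) (r * z) ^+ l) * (1 - r * z) = 1 - r ^+ N * z ^+ N.
  by rewrite -exprMn -opprB mulrN mulrC -subrX1 opprB.
rewrite (_ : _ * (1 - r * z) * _ = (1 - r ^+ N) * (1 - r * z) -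
   (1 - r) * z * ((\sum_(l < N) (r * z) ^+ l) * (1 - r * z))); last by field.
by rewrite S exprS; ring.
Qed.

(** After division by |1 - r z|, the main term is controlled by [norm1B_le] and each error is at
    most r^N, since 1 - r <= |1 - r z|. *)
Lemma norm_notch (C : numClosedFieldType) (r z : C) (N : nat) :
  0 <= r < 1 -> `|z| = 1 -> (0 < N)%N ->
  `|(notch r N).[z]| * (1 - r ^+ N) <= 2 / (1 + r) + 2 * r ^+ N.
Proof.
move=> /andP[r0 r1] z1 N0.
have rN : 0 < 1 - r ^+ N by rewrite subr_gt0 exprn_ilt1 // -lt0n.
have rz : 0 < 1 - r by rewrite subr_gt0.
have rz1 : 1 - r <= `|1 - r * z|.
  have := lerB_dist 1 (r * z).
  by rewrite normr1 normrM z1 mulr1 (ger0_norm r0).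
have nz : 0 < `|1 - r * z| by exact: lt_le_trans rz1.
have r1p : 0 < 1 + r by rewrite ltr_pwDl.
rewrite -(ler_pM2r nz) mulrAC.
have -> : `|(notch r N).[z]| * `|1 - r * z| * (1 - r ^+ N) =
    `|(notch r N).[z] * (1 - r * z) * (1 - r ^+ N)|.
  by rewrite !normrM (gtr0_norm rN).
rewrite horner_notchM ?gt_eqF //.
apply: le_trans (ler_normD _ _) _; apply: le_trans (lerD (ler_normB _ _) (lexx _)) _.
rewrite !normrM !normrX z1 expr1n mulr1 (ger0_norm r0) (gtr0_norm rz).
have rN0 : 0 <= r ^+ N by rewrite exprn_ge0.
rewrite [leRHS]mulrDl -addrA lerD //.
  rewrite mulrAC ler_pdivlMr // mulrC; exact: norm1B_le.
rewrite [leRHS](_ : _ = r ^+ N * `|1 - r * z| + `|1 - r * z| * r ^+ N); last by ring.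
by rewrite lerD2l ler_wpM2r.
Qed.

(** The bound 2k / (2k - 1) is chosen so that its k-th power is at most 2. With r = 1 - 1/(2k) the
    main term gives 4k / (4k - 1), and the gap between the two absorbs the truncation error once r^N
    <= 1/(16k). *)
Lemma exists_notch (C : numClosedFieldType) (k : nat) : (0 < k)%N ->
  exists p : {poly C}, [/\ (size p <= (32 * k ^ 2).+1)%N, p.[0] = 1, p.[1] = 0 &
    forall z, `|z| = 1 -> `|p.[z]| * (2 * k%:R - 1) <= 2 * k%:R].
Proof.
move=> k0; set N := (32 * k ^ 2)%N.
have N0 : (0 < N)%N by rewrite /N; nia.
have kC : 1 <= k%:R :> C by rewrite ler1n.
have two : 1 <= 2 :> C by rewrite ler1n.
have kC0 : 0 < k%:R :> C by rewrite ltr0n.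
have kV : 0 < (2 * k%:R)^-1 :> C by rewrite invr_gt0 mulr_gt0.
set r : C := 1 - (2 * k%:R)^-1.
have rb : 0 <= r < 1.
  rewrite /r subr_ge0 gtrBl kV andbT invf_le1 ?mulr_gt0 //.
  by rewrite (le_trans kC) // ler_peMl // ltW.
have [r0 r1] := andP rb.
have rN : 0 < 1 - r ^+ N by rewrite subr_gt0 exprn_ilt1 // -lt0n.
exists (notch r N); split; first exact: size_notch.
- by rewrite horner_notch mul0r mulr0 subr0.
- rewrite horner_notch mul1r mulr1.
  apply: (mulIf (lt0r_neq0 rN)); rewrite mul0r.
  rewrite mulrBl mul1r mulrAC mulfVK ?lt0r_neq0 //.
  by rewrite -(opprB r 1) mulNr -subrX1 opprB subrr.
move=> z z1; set e := r ^+ N; set a := `|_|; set c : C := k%:R in kC kC0 kV *.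
have e0 : 0 <= e by rewrite exprn_ge0.
(* Bernoulli gives (1 + 1/(2k))^N >= 1 + 16k for N = 32k^2, while r (1 + 1/(2k)) = 1 - 1/(4k^2) <=
   1. *)
have ce : 16 * c * e <= 1.
  have h : 16 * c <= (1 + (2 * c)^-1) ^+ N.
    apply: le_trans (bernoulli_le _ _); last by rewrite (le_trans (lerN10 _)) // ltW.
    rewrite /N natrM natrX -/c (_ : 32%:R * c ^+ 2 * _ = 16 * c) ?lerDr //.
    by field; rewrite lt0r_neq0.
  apply: le_trans (ler_wpM2r e0 h) _; rewrite mulrC.
  rewrite -exprMn; apply: exprn_ile1.
    by rewrite mulr_ge0 // addr_ge0 // ltW.
  rewrite /r -/c [leLHS](_ : _ = 1 - (2 * c)^-1 ^+ 2); last by ring.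
  by rewrite gerBl; apply/exprn_ge0/ltW.
have c4 : 0 < 4 * c - 1.
  by rewrite subr_gt0 (le_lt_trans kC) // ltr_pMl // ltr1n.
have c2 : 0 <= 2 * c - 1 by rewrite subr_ge0 (le_trans kC) // ler_peMl // ltW.
have := norm_notch rb z1 N0; rewrite -/e -/a.
have -> : 2 / (1 + r) = 4 * c / (4 * c - 1).
  by rewrite /r -/c; field; rewrite ?lt0r_neq0 // -?natrM.
move=> /(ler_wpM2r (ltW c4)); rewrite (mulrDl (_ / _)) mulfVK ?lt0r_neq0 // => ha.
rewrite -(ler_pM2r (mulr_gt0 rN c4)) -/e.
rewrite [leLHS](_ : _ = a * (1 - e) * (4 * c - 1) * (2 * c - 1)); last by ring.
apply: le_trans (ler_wpM2r c2 ha) _.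
rewrite -subr_ge0.
rewrite [X in 0 <= X](_ : _ = 2 * (c * (1 - 16 * c * e) + e * (4 * c ^+ 2 + 6 * c + (c - 1)))); last by ring.
have c0 := ltW kC0; have c1 : 0 <= c - 1 by rewrite subr_ge0.
have ce1 : 0 <= 1 - 16 * c * e by rewrite subr_ge0.
have s0 : 0 <= 4 * c ^+ 2 + 6 * c by rewrite addr_ge0 ?mulr_ge0 ?exprn_ge0.
by apply: mulr_ge0 => //; apply: addr_ge0; [exact: mulr_ge0|exact/mulr_ge0/addr_ge0].
Qed.

(** The polynomial is the product of the k rotated copies q(X / z_j) of the notch polynomial. Its
    degree is at most k * 32k^2, below the order of [w], so a bound by 2 at the powers of [w] passes
    to the coefficients. *)
Lemma exists_annihilator (C : numClosedFieldType) (k : nat) (z : 'I_k -> C) (w : C) :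
  (32 * k ^ 3).+1.-primitive_root w -> (forall j, `|z j| = 1) ->
  exists p : {poly C}, [/\ (size p <= (32 * k ^ 3).+1)%N, p`_0 = 1,
    forall j, p.[z j] = 0 & forall l, `|p`_l| <= 2].
Proof.
case: k z w => [|k] z w wP z1.
  by exists 1; split=> [|||l]; rewrite ?size_poly1 ?coef1 // ?normr_nat ?ler_nat; [case|case: eqP].
have [q [sq q0 q1 qB]] := @exists_notch C k.+1 isT.
have zj0 j : z j != 0 by rewrite -normr_eq0 z1 oner_eq0.
pose h j := q \Po ((z j)^-1 *: 'X).
have hE j x : (h j).[x] = q.[x / z j].
  by rewrite horner_comp hornerZ hornerX mulrC.
exists (\prod_j h j).
have sp : (size (\prod_j h j)%R <= (32 * k.+1 ^ 3).+1)%N.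
  rewrite (leq_trans (size_prod_leq _ _)) // card_ord leq_subLR.
  have sh j : (size (h j) <= (32 * k.+1 ^ 2).+1)%N.
    by rewrite size_comp_poly2 // size_scale ?size_polyX ?invr_eq0.
  have : (\sum_j size (h j) <= \sum_(j < k.+1) (32 * k.+1 ^ 2).+1)%N by apply: leq_sum.
  by rewrite sum_nat_const card_ord; lia.
split=> //.
- rewrite -horner_coef0 horner_prod big1 // => j _.
  by rewrite hE mul0r.
- by move=> j; rewrite horner_prod (bigD1 j) //= hE divff // q1 mul0r.
apply: (norm_coef_le wP sp) => i.
have wi : `|w ^+ i| = 1 by rewrite normrX (norm_prim_root wP) expr1n.
set c : C := k.+1%:R.
have c1 : 1 <= c by rewrite ler1n.
have c2 : 0 < 2 * c - 1 by rewrite subr_gt0 (le_lt_trans c1) // ltr_pMl ?ltr1n ?ltr0n.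
have c0 : 0 < 2 * c by rewrite mulr_gt0 // ltr0n.
have pB : `|(\prod_j h j).[w ^+ i]| * (2 * c - 1) ^+ k.+1 <= (2 * c) ^+ k.+1.
  have constE (y : C) : y ^+ k.+1 = \prod_(j < k.+1) y by rewrite prodr_const card_ord.
  rewrite horner_prod normr_prod !constE -big_split /=; apply: ler_prod => j _.
  rewrite mulr_ge0 ?(ltW c2) //= hE; apply: qB.
  by rewrite normrM normfV wi z1 invr1 mulr1.
(* Bernoulli at -1/(2k), with k the number of points, makes the k-th power of 2k / (2k - 1) at most
   2. *)
have /(ler_wpM2l (ltW (exprn_gt0 k.+1 c0))) : 2^-1 <= (1 - (2 * c)^-1) ^+ k.+1.
  apply: le_trans (bernoulli_le _ _); last first.
    by rewrite lerN2 invf_le1 // (le_trans c1) // ler_peMl ?ler1n ?ler0n.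
  rewrite -/c [leRHS](_ : _ = 2^-1) //; field.
  by rewrite nat1r pnatr_eq0.
rewrite -exprMn mulrBr mulr1 divff ?lt0r_neq0 // => h2.
rewrite -(ler_pM2r (exprn_gt0 k.+1 c2)); apply: le_trans pB _.
by rewrite [leRHS]mulrC -ler_pdivrMr ?ltr0n.
Qed.

(** * Complex exponentials and the shift inequality *)

Lemma expiD (R : realType) (x y : R) : expi (x + y) = expi x * expi y.
Proof. by rewrite /expi cosD sinD; congr Complex; rewrite addrC. Qed.

Lemma expi0 (R : realType) : expi (0 : R) = 1.
Proof. by rewrite /expi cos0 sin0. Qed.

Lemma expiMn (R : realType) (x : R) (n : nat) : expi (n%:R * x) = expi x ^+ n.
Proof.
elim: n => [|n IHn]; first by rewrite mul0r expi0 expr0.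
by rewrite -nat1r mulrDl mul1r expiD IHn exprS.
Qed.

Lemma sqmodE (R : realType) (z : R[i]) : (sqmod z)%:C%C = `|z| ^+ 2.
Proof. exact: add_Re2_Im2. Qed.

Lemma norm_expi (R : realType) (x : R) : `|expi x| = 1.
Proof. by rewrite normc_def /= cos2Dsin2 sqrtr1. Qed.

(** If the order m were less than n, the angle pi m / n would lie strictly between 0 and pi and have
    positive sine, so the cosine of its double could not be 1. *)
Lemma expi_primitive_root (R : realType) (n : nat) : (0 < n)%N ->
  n.-primitive_root (expi (2 * pi / n%:R : R)).
Proof.
move=> n0; have nR : 0 < n%:R :> R by rewrite ltr0n.
have wn : expi (2 * pi / n%:R : R) ^+ n = 1.
  rewrite -expiMn mulrC mulfVK ?lt0r_neq0 //.
  by rewrite /expi mulr_natl cos2pi sin2pi.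
have [m mP mn] := prim_order_exists n0 wn.
have m0 := prim_order_gt0 mP.
have [mE|mlt] : m = n \/ (m < n)%N by have := dvdn_leq n0 mn; lia.
  by rewrite -{1}mE.
have mnR : m%:R < n%:R :> R by rewrite ltr_nat.
have := prim_expr_order mP.
rewrite -expiMn (_ : _ * _ = (m%:R * pi / n%:R) *+ 2); last by rewrite -mulr_natl; ring.
move=> /(congr1 (@complex.Re R)); rewrite /= cos_mulr2n => /eqP.
have : 0 < sin (m%:R * pi / n%:R : R).
  apply: sin_gt0_pi; rewrite !(divr_gt0, mulr_gt0) ?pi_gt0 ?ltr0n //=.
  by rewrite ltr_pdivrMr // mulrC ltr_pM2l ?pi_gt0.
have := cos2Dsin2 (m%:R * pi / n%:R : R); set c := cos _; set s := sin _.
by move=> cs s0 /eqP c1; have := exprn_gt0 2 s0; lra.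
Qed.

Lemma sqr_sum_le (R : realDomainType) (n : nat) (a : 'I_n -> R) :
  (\sum_i a i) ^+ 2 <= n%:R * \sum_i a i ^+ 2.
Proof.
elim: n a => [|n IHn] a; first by rewrite !big_ord0 expr0n mulr0.
pose c i := a (widen_ord (leqnSn n) i).
rewrite !big_ord_recr -natr1 /=; set b := a ord_max.
rewrite -[\sum_i a _ ^+ 2]/(\sum_i c i ^+ 2) -[\sum_i a _]/(\sum_i c i).
have h : 2 * (\sum_i c i) * b <= \sum_i c i ^+ 2 + n%:R * b ^+ 2.
  rewrite mulr_natl -[X in X%:R * _]card_ord mulr_natl -sumr_const -big_split /=.
  rewrite -mulr_natl mulr_sumr mulr_suml; apply: ler_sum => i _.
  by have := sqr_ge0 (c i - b); lra.
by have := IHn c; lra.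
Qed.

(** The values x(t + l tau) are a combination of the powers z_j^l with z_j = [expi (g j * tau)], so
    the annihilator expresses x(t) by the shifted values. In the constant 4m, the 4 is the square of
    the coefficient bound and the m comes from Cauchy-Schwarz. *)
Lemma sqmod_shift_le (R : realType) (k : nat) (v : 'I_k -> R[i]) (g : 'I_k -> R)
    (t tau : R) :
  sqmod (\sum_j v j * expi (g j * t)) <=
    (4 * (32 * k ^ 3))%:R *
      \sum_(l < 32 * k ^ 3) sqmod (\sum_j v j * expi (g j * (t + l.+1%:R * tau))).
Proof.
set m := (32 * k ^ 3)%N; set x := fun s => \sum_j v j * expi (g j * s).
have [p [sp p0 pz pB]] := exists_annihilator (expi_primitive_root R (ltn0Sn m))
  (fun j => norm_expi (g j * tau)).
have E : \sum_(l < m.+1) p`_l * x (t + l%:R * tau) = 0.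
  under eq_bigr => l _ do rewrite mulr_sumr.
  rewrite exchange_big big1 // => j _.
  transitivity (v j * expi (g j * t) * p.[expi (g j * tau)]); last by rewrite pz mulr0.
  rewrite (horner_coef_wide _ sp) mulr_sumr; apply: eq_bigr => l _.
  by rewrite mulrDr expiD (mulrCA (g j)) expiMn; ring.
move: E; rewrite big_ord_recl p0 mul1r mul0r addr0 => /eqP.
rewrite addr_eq0 => /eqP E.
pose a l := Num.sqrt (sqmod (x (t + l.+1%:R * tau))).
have xa : Num.sqrt (sqmod (x t)) <= 2 * \sum_(l < m) a l.
  rewrite -lecR -normc_def E normrN rmorphM rmorph_nat rmorph_sum mulr_sumr.
  apply: le_trans (ler_norm_sum _ _ _) _; apply: ler_sum => l _.
  rewrite normrM [X in _ * X]normc_def; apply: ler_wpM2r; last exact: pB.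
  by rewrite ler0c sqrtr_ge0.
have s0 z : 0 <= sqmod z :> R by rewrite addr_ge0 ?sqr_ge0.
rewrite -[leLHS]sqr_sqrtr //.
have : Num.sqrt (sqmod (x t)) ^+ 2 <= (2 * \sum_(l < m) a l) ^+ 2.
  by rewrite ler_sqr // nnegrE ?sqrtr_ge0 // mulr_ge0 // sumr_ge0 // => l _; exact: sqrtr_ge0.
move=> /le_trans; apply; rewrite exprMn natrM -mulrA -natrX ler_wpM2l //.
apply: le_trans (sqr_sum_le _) _; rewrite ler_wpM2l //.
by apply: ler_sum => l _; rewrite sqr_sqrtr.
Qed.

(** * Derivatives, primitives and averaging over the shift *)

Lemma is_derive_bigsum (R : realType) (I : Type) (r : seq I) (F : I -> R -> R)
    (dF : I -> R) (x : R) :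
  (forall i, is_derive x 1 (F i) (dF i)) ->
  is_derive x 1 (fun y => \sum_(i <- r) F i y) (\sum_(i <- r) dF i).
Proof.
move=> dFi; elim: r => [|i r IHr].
  rewrite big_nil (_ : (fun _ => _) = cst 0); last by apply: funext => y; rewrite big_nil.
  exact: is_derive_cst.
rewrite big_cons (_ : (fun _ => _) = F i + (fun y => \sum_(j <- r) F j y)).
  exact: is_deriveD.
by apply: funext => y; rewrite big_cons.
Qed.

Lemma is_derive_continuous (R : realType) (F f : R -> R) :
  (forall x : R, is_derive x 1 F (f x)) -> continuous F.
Proof.
move=> dF x; apply: differentiable_continuous; apply/derivable1_diffP.
by have [] := dF x.
Qed.

Lemma ge0_derive_le (R : realType) (F f : R -> R) :
  (forall x : R, is_derive x 1 F (f x)) -> (forall x, 0 <= f x) ->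
  {homo F : x y / x <= y}.
Proof.
move=> dF f0 x y xy; have cF := is_derive_continuous dF.
have [z _ E] := @MVT_segment R F f x y xy (fun z _ => dF z) (continuous_subspaceT cF).
by rewrite -subr_ge0 E mulr_ge0 // subr_ge0.
Qed.

Lemma Rintegral_derive (R : realType) (F f : R -> R) (a b : R) : a < b ->
  (forall x : R, is_derive x 1 F (f x)) -> continuous f ->
  (\int[@lebesgue_measure R]_(x in `[a, b]) f x)%R = F b - F a.
Proof.
move=> ab dF cf; have cF := is_derive_continuous dF.
rewrite /Rintegral (@continuous_FTC2 _ f F) //.
- exact: continuous_subspaceT.
- split => [x _| |]; first by have [] := dF x.
  + by apply: cvg_at_right_filter; exact: cF.
  + by apply: cvg_at_left_filter; exact: cF.
- by move=> x _; rewrite derive1E; have [_ ->] := dF x.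
Qed.

Lemma continuous_integrable_itv (R : realType) (f : R -> R) (a b : R) :
  continuous f -> (@lebesgue_measure R).-integrable `[a, b]%classic (EFin \o f).
Proof.
move=> cf; apply: continuous_compact_integrable; first exact: segment_compact.
exact: continuous_subspaceT.
Qed.

(* Integrating the hypothesis over the dilation [tau] replaces each shifted value
   by an increment of [Q]; shifting to the left when [t] lies in the right half
   of [0, T] keeps all points in the interval. *)
Lemma le_increment_of_shift_le (R : realType) (q Q : R -> R) (A T t : R) (m : nat) :
  (forall x : R, is_derive x 1 Q (q x)) -> (forall x, 0 <= q x) ->
  0 <= A -> 0 < T -> 0 <= t <= T -> (0 < m)%N ->
  (forall tau, q t <= A * \sum_(l < m) q (t + l.+1%:R * tau)) ->
  q t <= 2 * A * m%:R ^+ 2 / T * (Q T - Q 0).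
Proof.
move=> dQ q0 A0 T0 /andP[t0 tT] m0 qA.
have mR : 0 < m%:R :> R by rewrite ltr0n.
have Qle := ge0_derive_le dQ q0.
(* With this step size the m shifts move [t] by at most T/2. *)
pose h := T / (2 * m%:R).
have h0 : 0 < h by rewrite divr_gt0 // mulr_gt0.
suff [s s1 sT] : exists2 s : R, s ^+ 2 = 1 & forall l : 'I_m,
    s * (Q (t + s * (l.+1%:R * h)) - Q t) <= Q T - Q 0.
  (* The sign [s] is the direction of the shifts. [Phi] is, up to a constant, a primitive of the gap
     in the hypothesis at tau = s x, hence nondecreasing; [s / l.+1] is the inverse of the dilation
     factor because s^2 = 1. *)
  pose Phi x := A * (\sum_(l < m) s / l.+1%:R * Q (t + s * l.+1%:R * x)) - x * q t.
  have dPhi (x : R) : is_derive x 1 Phi (A * (\sum_(l < m) q (t + l.+1%:R * (s * x))) - q t).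
    have dsum : is_derive x 1 (fun x => \sum_(l < m) s / l.+1%:R * Q (t + s * l.+1%:R * x))
        (\sum_(l < m) q (t + l.+1%:R * (s * x))).
      apply: is_derive_bigsum => l.
      have dl : is_derive x 1 (fun x : R => t + s * l.+1%:R * x) (s * l.+1%:R).
        by apply: is_derive_eq; rewrite add0r mul1r /GRing.scale /= mulr1.
      have dc := @is_derive1_comp R Q _ x _ _ (dQ _) dl.
      have dz := @is_deriveZ _ _ _ _ (s / l.+1%:R) _ _ _ dc.
      apply: (@is_derive_eq _ _ _ _ _ _ _ _ dz).
      have -> : t + s * l.+1%:R * x = t + l.+1%:R * (s * x) by ring.
      transitivity (s ^+ 2 * q (t + l.+1%:R * (s * x))); last by rewrite s1 mul1r.
      rewrite /GRing.scale /=.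
      by field; rewrite nat1r pnatr_eq0.
    apply: is_derive_eq.
    by rewrite /GRing.scale /= mulr0 add0r mulr1.
  have dPhi0 x : 0 <= A * \sum_(l < m) q (t + l.+1%:R * (s * x)) - q t.
    by rewrite subr_ge0.
  have := ge0_derive_le dPhi dPhi0 (ltW h0).
  rewrite /Phi mul0r subr0.
  under eq_bigr => l _ do rewrite mulr0 addr0.
  rewrite lerBrDr addrC -lerBrDr -mulrBr -sumrB => hq.
  have {}hq : h * q t <= A * (m%:R * (Q T - Q 0)).
    apply: le_trans hq _; apply: ler_wpM2l => //.
    rewrite mulr_natl -[X in _ *+ X]card_ord -sumr_const; apply: ler_sum => l _.
    have l0 : 0 < l.+1%:R :> R by rewrite ltr0n.
    have QT : 0 <= Q T - Q 0 by rewrite subr_ge0 Qle // ltW.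
    rewrite -mulrBr mulrAC ler_pdivrMr // -(mulrA s).
    apply: le_trans (sT l) _.
    by rewrite ler_peMr // ler1n.
  rewrite -(ler_pM2l h0); apply: le_trans hq _.
  rewrite [leRHS](_ : _ = A * (m%:R * (Q T - Q 0))) //.
  by rewrite /h; field; rewrite !lt0r_neq0.
have lh (l : 'I_m) : 0 <= l.+1%:R * h <= T / 2.
  rewrite mulr_ge0 ?(ltW h0) //= (_ : T / 2 = m%:R * h).
    by rewrite ler_wpM2r ?(ltW h0) // ler_nat.
  by rewrite /h; field; rewrite lt0r_neq0.
case: (leP t (T / 2)) => tT2; [exists 1|exists (-1)]; rewrite ?sqrrN ?expr1n // => l;
  have /andP[l0 l1] := lh l.
  rewrite !mul1r lerB // Qle //; lra.
rewrite !mulN1r opprB lerB // Qle //; lra.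
Qed.

(** * Explicit integrals of exponential sums *)

(* The integral of expi (g * x) for x from 0 to s. *)
Definition expi_int (R : realType) (g s : R) : R[i] :=
  if g == 0 then s%:C%C else Complex (sin (g * s) / g) ((1 - cos (g * s)) / g).

Lemma expi_int0 (R : realType) (g : R) : expi_int g 0 = 0.
Proof.
rewrite /expi_int; case: ifP => // _.
by rewrite mulr0 sin0 cos0 subrr !mul0r.
Qed.

(** Real parts with an arbitrary complex factor keep all calculus over the reals, and squared moduli
    of signals have this form. *)
Lemma is_derive_Re_expi_int (R : realType) (c : R[i]) (g x : R) :
  is_derive x 1 (fun s => complex.Re (c * expi_int g s)) (complex.Re (c * expi (g * x))).
Proof.
case: c => a b; rewrite /expi_int; case: eqP => [->|/eqP g0].
  rewrite mul0r expi0 /=; apply: is_derive_eq.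
  by rewrite /GRing.scale /=; ring.
rewrite /=; apply: is_derive_eq.
by rewrite /GRing.scale /=; field.
Qed.

Lemma Re_sum (R : realType) (I : Type) (r : seq I) (F : I -> R[i]) :
  complex.Re (\sum_(i <- r) F i) = \sum_(i <- r) complex.Re (F i).
Proof. exact: (raddf_sum (@complex.Re R : Rcomplex R -> R)). Qed.

Lemma is_derive_Re_expi (R : realType) (c : R[i]) (g x : R) :
  is_derive x 1 (fun s => complex.Re (c * expi (g * s)))
    (- (g * complex.Im (c * expi (g * x)))).
Proof.
by case: c => a b /=; apply: is_derive_eq; rewrite /GRing.scale /=; ring.
Qed.

Lemma continuous_Re_sum_expi (R : realType) (M : finType) (c : M -> R[i]) (g : M -> R) :
  continuous (fun s : R => complex.Re (\sum_m c m * expi (g m * s))).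
Proof.
rewrite (_ : (fun _ => _) = fun s => \sum_m complex.Re (c m * expi (g m * s))).
  by apply: is_derive_continuous => x; apply: is_derive_bigsum => m; exact: is_derive_Re_expi.
by apply: funext => s; rewrite Re_sum.
Qed.

Lemma is_derive_Re_sum_expi_int (R : realType) (M : finType) (c : M -> R[i])
    (g : M -> R) (x : R) :
  is_derive x 1 (fun s => complex.Re (\sum_m c m * expi_int (g m) s))
    (complex.Re (\sum_m c m * expi (g m * x))).
Proof.
rewrite Re_sum (_ : (fun _ => _) = fun s => \sum_m complex.Re (c m * expi_int (g m) s)).
  by apply: is_derive_bigsum => m; exact: is_derive_Re_expi_int.
by apply: funext => s; rewrite Re_sum.
Qed.

Lemma Rintegral_Re_sum_expi (R : realType) (M : finType) (c : M -> R[i]) (g : M -> R)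
    (T : R) : 0 < T ->
  (\int[@lebesgue_measure R]_(s in `[0%R, T]) complex.Re (\sum_m c m * expi (g m * s)))%R =
    complex.Re (\sum_m c m * expi_int (g m) T).
Proof.
move=> T0.
rewrite (Rintegral_derive T0 (is_derive_Re_sum_expi_int c g) (@continuous_Re_sum_expi R M c g)).
rewrite [X in _ - complex.Re X]big1 /= ?subr0 // => m _.
by rewrite expi_int0 mulr0.
Qed.

(** Each [E m] is a product of one-variable integrals. Its independence of [c] is essential: an
    outer variable can be absorbed into the coefficients, both in this induction and when the result
    is viewed as a function of that variable. *)
Lemma iter_int_Re_sum_expi (R : realType) (M : finType) (T : R) (n : nat)
    (g : M -> nat -> R) : 0 < T ->
  exists E : M -> R[i], forall c : M -> R[i],
    iter_int T n (fun u => complex.Re (\sum_m c m * expi (\sum_(i < n) g m i * u i))) =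
    complex.Re (\sum_m c m * E m).
Proof.
move=> T0; elim: n => [|n [E hE]].
  by exists (fun=> 1) => c /=; under eq_bigr => m _ do rewrite big_ord0 expi0.
exists (fun m => expi_int (g m n) T * E m) => c /=.
have hs s : iter_int T n (fun u => complex.Re (\sum_m c m *
      expi (\sum_(i < n.+1) g m i * (if i == n :> nat then s else u i)))) =
    complex.Re (\sum_m c m * E m * expi (g m n * s)).
  under [in RHS]eq_bigr => m _ do rewrite mulrAC.
  rewrite -hE; congr iter_int; apply: funext => u; congr complex.Re; apply: eq_bigr => m _.
  rewrite big_ord_recr /= eqxx addrC expiD mulrA; congr (_ * expi _).
  by apply: eq_bigr => i _; rewrite ltn_eqF.
under eq_Rintegral => s _ do rewrite hs.
rewrite (Rintegral_Re_sum_expi (fun m => c m * E m) (g^~ n) T0).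
by congr complex.Re; apply: eq_bigr => m _; rewrite -!mulrA (mulrC (E m)).
Qed.

(** * The bound in one variable, then one coordinate at a time *)

(** Expanding x times its conjugate gives an exponential sum over pairs, with differences of
    frequencies, to which the explicit integrals apply. *)
Lemma sqmod_sum_expi (R : realType) (k : nat) (v : 'I_k -> R[i]) (th : 'I_k -> R) :
  sqmod (\sum_j v j * expi (th j)) =
    complex.Re (\sum_(p : 'I_k * 'I_k)
      v p.1 * conjc (v p.2) * expi (th p.1 - th p.2)).
Proof.
have -> (z : R[i]) : sqmod z = complex.Re (z * conjc z).
  by case: z => a b; rewrite /sqmod /=; ring.
rewrite rmorph_sum big_distrlr /= pair_bigA /=; congr complex.Re.
apply: eq_bigr => -[i j] _ /=; rewrite rmorphM expiD.
have -> : expi (- th j) = conjc (expi (th j)) by rewrite /expi cosN sinN.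
by rewrite mulrACA.
Qed.

Lemma sqmod_ge0 (R : realType) (z : R[i]) : 0 <= sqmod z.
Proof. by rewrite addr_ge0 ?sqr_ge0. Qed.

Lemma sqmod_le_Rintegral (R : realType) (k : nat) (v : 'I_k -> R[i]) (g : 'I_k -> R)
    (T t : R) : 0 < T -> 0 <= t <= T ->
  sqmod (\sum_j v j * expi (g j * t)) <= (k ^ 27)%:R / T *
    (\int[@lebesgue_measure R]_(s in `[0%R, T]) sqmod (\sum_j v j * expi (g j * s)))%R.
Proof.
move=> T0 tT.
(* The numerical constant can be absorbed into a power of k only for k > 1. For k = 0 both sides
   vanish, and for k = 1 the modulus is constant. *)
have [k0|[k1|k2]] : k = 0%N \/ k = 1%N \/ (1 < k)%N by lia.
- by subst k; rewrite big_ord0 /sqmod /= expr0n /= addr0 !mul0r.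
- subst k.
  have sE s : sqmod (\sum_(j < 1) v j * expi (g j * s)) = sqmod (v ord0).
    by apply: complexI; rewrite !sqmodE big_ord1 normrM norm_expi mulr1.
  under eq_Rintegral => s _ do rewrite sE.
  rewrite sE Rintegral_cst //= lebesgue_measure_itv /= lte_fin T0 /=.
  by rewrite exp1n oppr0 addr0 mulrC mul1r mulfK // lt0r_neq0.
pose c (p : 'I_k * 'I_k) := v p.1 * conjc (v p.2).
pose w (p : 'I_k * 'I_k) := g p.1 - g p.2.
pose Q s := complex.Re (\sum_p c p * expi_int (w p) s).
have qE s : sqmod (\sum_j v j * expi (g j * s)) = complex.Re (\sum_p c p * expi (w p * s)).
  rewrite sqmod_sum_expi; congr complex.Re; apply: eq_bigr => p _.
  by rewrite -mulrBl.
have dQ (s : R) : is_derive s 1 Q (sqmod (\sum_j v j * expi (g j * s))).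
  by rewrite qE; exact: is_derive_Re_sum_expi_int.
have m0 : (0 < 32 * k ^ 3)%N by rewrite muln_gt0 expn_gt0; lia.
have H := le_increment_of_shift_le dQ (fun s => sqmod_ge0 _) (ler0n _ _) T0 tT m0
  (sqmod_shift_le v g t).
apply: le_trans H _.
under eq_Rintegral => s _ do rewrite qE.
rewrite (Rintegral_Re_sum_expi c w T0).
have Q0 : Q 0 = 0 by rewrite /Q big1 // => p _; rewrite expi_int0 mulr0.
have QT : 0 <= Q T.
  by rewrite -Q0; apply: (ge0_derive_le dQ) => [s|]; [exact: sqmod_ge0|exact: ltW].
rewrite Q0 subr0 ler_wpM2r // ler_wpM2r ?invr_ge0 ?(ltW T0) //.
rewrite -natrX -!natrM ler_nat.
(* With m = 32k^3 and A = 4m, the constant 2 A m^2 equals 8 m^3 = 2^18 k^9, and 2 <= k yields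
   k^27. *)
have : (2 ^ 18 * k ^ 9 <= k ^ 18 * k ^ 9)%N by rewrite leq_mul2r leq_exp2r ?k2 ?orbT.
rewrite -expnD; apply: leq_trans.
apply: eq_leq; ring.
Qed.

(** The one-variable bound is applied in the last coordinate with the others frozen in the
    coefficients [w']. The induction hypothesis is then used under the integral, for the signal with
    coefficients [w s]. *)
Lemma sqmod_le_iter_int (R : realType) (k : nat) (T : R) (n : nat) (v : 'I_k -> R[i])
    (g : 'I_k -> nat -> R) (t : nat -> R) :
  0 < T -> (forall i, (i < n)%N -> 0 <= t i <= T) ->
  sqmod (\sum_j v j * expi (\sum_(i < n) g j i * t i)) <=
    ((k ^ 27)%:R / T) ^+ n *
    iter_int T n (fun u => sqmod (\sum_j v j * expi (\sum_(i < n) g j i * u i))).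
Proof.
move=> T0; elim: n v => [|n IHn] v tT.
  have E u : \sum_j v j * expi (\sum_(i < 0) g j i * u i) = \sum_j v j.
    by apply: eq_bigr => j _; rewrite big_ord0 expi0 mulr1.
  by rewrite expr0 mul1r /= !E.
set K := (k ^ 27)%:R / T.
pose w s j := v j * expi (g j n * s).
have split_last (u : nat -> R) s :
    \sum_j v j * expi (\sum_(i < n.+1) g j i * (if i == n :> nat then s else u i)) =
    \sum_j w s j * expi (\sum_(i < n) g j i * u i).
  apply: eq_bigr => j _; rewrite big_ord_recr /= eqxx addrC expiD mulrA; congr (_ * expi _).
  by apply: eq_bigr => i _; rewrite ltn_eqF.
pose w' j := v j * expi (\sum_(i < n) g j i * t i).
have wE s : \sum_j w s j * expi (\sum_(i < n) g j i * t i) = \sum_j w' j * expi (g j n * s).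
  by apply: eq_bigr => j _; rewrite mulrAC.
have -> : \sum_j v j * expi (\sum_(i < n.+1) g j i * t i) = \sum_j w' j * expi (g j n * t n).
  by rewrite -wE; apply: eq_bigr => j _; rewrite big_ord_recr /= addrC expiD mulrA.
apply: le_trans (sqmod_le_Rintegral w' (g^~ n) T0 (tT n (ltnSn n))) _.
rewrite -/K exprS -mulrA.
have K0 : 0 <= K by rewrite divr_ge0 ?ler0n ?ltW.
apply: ler_wpM2l => //=.
pose vv (p : 'I_k * 'I_k) := v p.1 * conjc (v p.2).
pose gg (p : 'I_k * 'I_k) i := g p.1 i - g p.2 i.
have [E hE] := iter_int_Re_sum_expi n gg T0.
(* The inner iterated integral is an explicit exponential sum in the outer variable, hence
   continuous and integrable, as monotonicity of the integral requires. *)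
pose G s := complex.Re (\sum_p vv p * E p * expi (gg p n * s)).
have GE s : iter_int T n (fun u => sqmod (\sum_j w s j * expi (\sum_(i < n) g j i * u i))) = G s.
  rewrite /G; under [in RHS]eq_bigr => p _ do rewrite mulrAC.
  rewrite -hE; congr iter_int; apply: funext => u.
  rewrite sqmod_sum_expi; congr complex.Re; apply: eq_bigr => p _.
  rewrite /w rmorphM mulrACA -/(vv p) -sumrB; congr (_ * _ * expi _).
    by rewrite /gg mulrBl expiD /expi /= cosN sinN.
  by apply: eq_bigr => i _; rewrite mulrBl.
have cG : continuous G by exact: continuous_Re_sum_expi.
have int_G : (\int[@lebesgue_measure R]_(s in `[0%R, T]) iter_int T n (fun u =>
      sqmod (\sum_j v j * expi (\sum_(i < n.+1) g j i * (if i == n :> nat then s else u i)))))%R =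
    (\int[@lebesgue_measure R]_(s in `[0%R, T]) G s)%R.
  apply: eq_Rintegral => s _; rewrite -GE; congr iter_int; apply: funext => u.
  by rewrite split_last.
rewrite int_G -RintegralZl //; last exact: continuous_integrable_itv.
apply: le_Rintegral => //.
- apply: continuous_integrable_itv.
  rewrite (_ : (fun _ => _) = fun s => complex.Re (\sum_(p : 'I_k * 'I_k)
     w' p.1 * conjc (w' p.2) * expi (gg p n * s))); first exact: continuous_Re_sum_expi.
  apply: funext => s; rewrite sqmod_sum_expi; congr complex.Re.
  by apply: eq_bigr => p _; rewrite -mulrBl.
- apply: continuous_integrable_itv => s; apply: cvgM; [exact: cvg_cst|exact: cG].
move=> s _; rewrite -wE -GE; apply: IHn => i ltin.
by apply: tT; rewrite ltnW.
Qed.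

Theorem theorem5p3 :
  exists C : nat, forall (R : realType) (d k : nat) (v : 'I_k -> R[i])
    (f : 'I_k -> 'rV[R]_d) (T : R), 0 < T ->
    forall t : 'rV[R]_d, @cube R d T t ->
      sqmod (sparse_signal v f t) <=
        (k ^ (C * d))%:R * normT2 T (sparse_signal v f).
Proof.
exists 27%N => R d k v f T T0 t tT.
(* Frequencies, with 2 pi absorbed, and the point are extended by 0 to all natural indices, matching
   the coordinates of [iter_int]. *)
pose g j i := oapp (fun i : 'I_d => 2 * pi * f j ord0 i) 0 (insub i).
have gE j (i : 'I_d) : g j i = 2 * pi * f j ord0 i by rewrite /g valK.
pose t' i := oapp (t ord0) 0 (insub i).
have tE (i : 'I_d) : t' i = t ord0 i by rewrite /t' valK.
have xE (u : nat -> R) : sparse_signal v f (\row_(i < d) u i) =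
    \sum_j v j * expi (\sum_(i < d) g j i * u i).
  apply: eq_bigr => j _; rewrite /dotR mulr_sumr; congr (_ * expi _).
  by apply: eq_bigr => i _; rewrite mxE gE mulrA.
have -> : t = \row_(i < d) t' i by apply/rowP => i; rewrite mxE tE.
rewrite xE; apply: le_trans (sqmod_le_iter_int v g T0 (_ : forall i, _)) _.
  by move=> i ltid; have := tT (Ordinal ltid); rewrite -tE.
rewrite /normT2 /cube_integral mulrA expr_div_n -natrX -expnM.
by under [X in _ <= _ * iter_int _ _ X]funext => u do rewrite xE.
Qed.
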